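(* Let $\mathbb{F}\in\{\mathbb{R},\mathbb{C}\}$, let $H$ be a Hilbert space over $\mathbb{F}$ and let $A\in B(H)$ be self-adjoint. Given the $*$-algebra of regulated functions $\mathrm{Reg}_{\mathbb{F}}(\sigma(A))$, the map $$\Phi^{HK}_A:\mathrm{Reg}_{\mathbb{F}}(\sigma(A))\to B(H),\qquad f\mapsto f(A),$$ is a $*$-algebra homomorphism; that is, for all $f_1,f_2,f_3\in\mathrm{Reg}_{\mathbb{F}}(\sigma(A))$ and $\alpha_1,\alpha_2\in\mathbb{F}$: 1. $\Phi^{HK}_A(\alpha_1f_1+\alpha_2f_2)=\alpha_1\Phi^{HK}_A(f_1)+\alpha_2\Phi^{HK}_A(f_2)$; 2. $\Phi^{HK}_A(f_1f_2)=\Phi^{HK}_A(f_1)\Phi^{HK}_A(f_2)$; 3. $\Phi^{HK}_A(\overline{f_3})=(\Phi^{HK}_A(f_3))^*$; 4. $\Phi^{HK}_A(1)=1_{B(H)}$, where $1$ is the constant function one and $1_{B(H)}$ the identity operator.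
   Context: Inner products are linear in the first variable; $B(H)$ is the algebra of bounded linear operators on $H$. Regulated functions: for a compact set $K\subseteq\mathbb{R}$, a function $f:K\to\mathbb{F}$ is regulated if all its left and right limits exist on $K$. $\mathrm{Reg}_{\mathbb{F}}(K)$ is the set of these functions, a $*$-algebra under pointwise operations with complex conjugation as involution. Measures: $E$ is the unique projection-valued measure on the Borel sets of $\sigma(A)$ with $A=\int_{\sigma(A)}\lambda\,dE(\lambda)$, and $\mu_{x,y}(B)=\langle E(B)x,y\rangle$ for Borel $B\subseteq\sigma(A)$ and $x,y\in H$. HK integral: let $K=\sigma(A)$. A gauge is a function $\gamma:K\to(0,\infty)$. An exhaustive $K$-division is a finite set of reals $p_0<p_1<\dots<p_n$ with $p_0<\min K$ and $\max K<p_n$. Given such a division, a $K$-cell is any set $K\cap J$ with $J$ one of $[p_{i-1},p_i]$, $[p_{i-1},p_i)$, $(p_{i-1},p_i]$, $(p_{i-1},p_i)$. A partition of $K$ is a finite collection of $K$-cells $C_1,\dots,C_m$ with $\bigcup_jC_j=K$. A tagged partition is a partition together with points $t_1,\dots,t_m$, each sitting in precisely one $K$-cell, $t_j\in C_j$. A gauge-fine tagged partition $\widehat P_\gamma$ is a tagged partition with $C_j\subseteq(t_j-\gamma(t_j),t_j+\gamma(t_j))\cap K$ for all $j$. Its $\mu_{x,y}$-HK sum is $S(f,\mu_{x,y},\widehat P_\gamma)=\sum_jf(t_j)\mu_{x,y}(C_j)$. A function $f:K\to\mathbb{F}$ is $\mu_{x,y}$-HK-integrable with integral $I_{x,y}(f)$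 if $$(\forall\varepsilon>0)(\exists\gamma\text{ a gauge})(\forall x,y\in H)(\exists I_{x,y}(f)\in\mathbb{F})(\forall\text{ gauge-fine tagged partitions }\widehat P_\gamma):\ |S(f,\mu_{x,y},\widehat P_\gamma)-I_{x,y}(f)|<\varepsilon.$$ Operator $f(A)$: for $f\in\mathrm{Reg}_{\mathbb{F}}(\sigma(A))$, $(x,y)\mapsto I_{x,y}(f)$ is a bounded sesquilinear form, and $f(A)\in B(H)$ is the unique operator with $\langle f(A)x,y\rangle=I_{x,y}(f)$ for all $x,y\in H$.
   Formalization: The printed HK definition, with one gauge for all x,y, leaves even f(t)=t for multiplication by t on L^2[0,1] non-integrable; here the gauge may depend on x,y, I_{x,y}(f) is fixed before epsilon, and the cells of a partition are pairwise disjoint. *)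

(* Defs.v *)
From HB Require Import structures.
From mathcomp Require Import all_boot all_order all_algebra.
From mathcomp Require Import all_classical all_reals all_analysis.
From mathcomp Require Import complex sesquilinear.

Set Implicit Arguments.
Unset Strict Implicit.
Unset Printing Implicit Defensive.

Import Order.TTheory GRing.Theory Num.Theory.
Import numFieldNormedType.Exports.

Local Open Scope classical_set_scope.
Local Open Scope ring_scope.

Inductive scalar_kind := RealScalars | ComplexScalars.

Definition scalars (R : realType) (k : scalar_kind) : numFieldType :=
  match k with RealScalars => R | ComplexScalars => R[i] end.

Definition of_real (R : realType) (k : scalar_kind) : R -> scalars R k :=
  match k with
  | RealScalars => fun r => r
  | ComplexScalars => fun r => (r%:C)%C
  end.

Definition scalar_conj (R : realType) (k : scalar_kind) :
    scalars R k -> scalars R k :=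
  match k with
  | RealScalars => fun z => z
  | ComplexScalars => fun z => (z^*)%C
  end.

Section operators.
Context (F : numFieldType) (H : normedModType F) (dot : H -> H -> F).

Definition bounded_operator (T : H -> H) : Prop :=
  linear T /\ exists M : F, forall x, `|T x| <= M * `|x|.

Definition adjoint_of (T S : H -> H) : Prop :=
  forall x y, dot (T x) y = dot x (S y).

Definition self_adjoint (T : H -> H) : Prop := adjoint_of T T.

(* On a Hilbert space the set below is a singleton for bounded T; the zero
   operator is only the default value required by xget. *)
Definition adjoint (T : H -> H) : H -> H :=
  xget (fun=> 0) [set S | bounded_operator S /\ adjoint_of T S].

Definition spectrum (T : H -> H) : set F :=
  [set l | ~ exists2 S, bounded_operator S &
             let Tl := fun x => T x - l *: x in cancel Tl S /\ cancel S Tl].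

Definition orthogonal_projection (P : H -> H) : Prop :=
  [/\ bounded_operator P, P \o P = P & self_adjoint P].

End operators.

(* The spectrum of a self-adjoint operator consists of reals, so nothing is
   lost by taking its real points; this makes it a subset of R. *)
Definition real_spectrum (R : realType) (k : scalar_kind)
    (H : normedModType (scalars R k)) (A : H -> H) : set R :=
  [set r | spectrum A (of_real k r)].

Section projection_valued_measures.
Context (R : realType) (F : numFieldType) (H : normedModType F)
        (dot : H -> H -> F).
Implicit Types (K : set R) (E : set R -> H -> H).

Definition borel_in K (B : set R) : Prop :=
  measurable (B : set (measurableTypeR R)) /\ B `<=` K.

(* Countable additivity is in the strong operator topology.  The values of E
   on sets that are not Borel subsets of K are irrelevant. *)
Definition projection_valued_measure K E : Prop :=
  [/\ forall B, borel_in K B -> orthogonal_projection dot (E B),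
      E set0 = (fun=> 0) /\ E K = idfun,
      forall B C, borel_in K B -> borel_in K C -> E (B `&` C) = E B \o E C
    & forall B : nat -> set R, (forall i, borel_in K (B i)) ->
        trivIset setT B ->
        forall x, \sum_(0 <= i < n) E (B i) x @[n --> \oo]
                  --> E (\bigcup_i B i) x].

(* T is the integral over K of the bounded Borel function phi with respect
   to E: the operator-norm limit of the integrals of simple functions
   approximating phi uniformly. *)
Definition pvm_integral K E (phi : R -> F) (T : H -> H) : Prop :=
  forall e : F, 0 < e ->
  forall (m : nat) (t : 'I_m -> R) (B : 'I_m -> set R),
    (forall j, borel_in K (B j)) ->
    trivIset setT B -> \bigcup_j B j = K ->
    (forall j, B j (t j)) ->
    (forall j s s', B j s -> B j s' -> `|phi s - phi s'| <= e) ->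
  forall x, `|T x - \sum_(j < m) phi (t j) *: E (B j) x| <= e * `|x|.

End projection_valued_measures.

Definition spectral_measure (R : realType) (k : scalar_kind)
    (H : normedModType (scalars R k)) (dot : H -> H -> scalars R k)
    (A : H -> H) (E : set R -> H -> H) : Prop :=
  projection_valued_measure dot (real_spectrum A) E /\
  pvm_integral (real_spectrum A) E (@of_real R k) A.

Section henstock_kurzweil.
Context (R : realType) (F : numFieldType).
Implicit Types (K C : set R) (p : seq R) (gamma : R -> R) (mu : set R -> F)
               (f : R -> F).

(* Functions on K are represented by total functions on R, of which only the
   values on K are ever used.  At a point of K that is not a limit point of K
   from one side, the limit from that side imposes no condition. *)
Definition regulated K f : Prop :=
  forall t, K t ->
    (exists l : F, f s @[s --> within (K `&` [set s | s < t]) (nbhs t)] --> l) /\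
    (exists l : F, f s @[s --> within (K `&` [set s | t < s]) (nbhs t)] --> l).

(* For nonempty compact K the second condition says p_0 < min K and
   max K < p_n; it is void when K is empty, i.e. when the space is zero. *)
Definition exhaustive_division K p : Prop :=
  [/\ (0 < size p)%N, sorted <%R p
    & forall t, K t -> p`_0 < t < p`_(size p).-1].

(* The two booleans give the four kinds of intervals. *)
Definition division_cell K p C : Prop :=
  exists i (b c : bool), (i.+1 < size p)%N /\
    C = K `&` [set` Interval (BSide b p`_i) (BSide c p`_i.+1)].

(* The cells of a partition are pairwise disjoint.  Without this, for instance
   [p, q) tagged at p and (p, q] tagged at q could both be used, and constants
   would not be integrable with respect to Lebesgue measure. *)
Definition tagged_partition K m (t : 'I_m -> R) (C : 'I_m -> set R) : Prop :=
  [/\ exists2 p, exhaustive_division K p & forall j, division_cell K p (C j),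
      \bigcup_j C j = K,
      trivIset setT C
    & forall i j, C i (t j) <-> i = j].

Definition gauge_fine K gamma m (t : 'I_m -> R) (C : 'I_m -> set R) : Prop :=
  forall j, C j `<=` `]t j - gamma (t j), t j + gamma (t j)[ `&` K.

Definition HK_sum f mu m (t : 'I_m -> R) (C : 'I_m -> set R) : F :=
  \sum_(j < m) f (t j) * mu (C j).

Definition HK_integral K mu f (I : F) : Prop :=
  forall e : F, 0 < e ->
  exists2 gamma : R -> R, (forall t, K t -> 0 < gamma t) &
    forall m (t : 'I_m -> R) (C : 'I_m -> set R),
      tagged_partition K t C -> gauge_fine K gamma t C ->
      `|HK_sum f mu t C - I| < e.

End henstock_kurzweil.

Section functional_calculus.
Context (R : realType) (k : scalar_kind) (H : normedModType (scalars R k))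
        (dot : H -> H -> scalars R k) (A : H -> H) (E : set R -> H -> H).

Definition spectral_mu (x y : H) (B : set R) : scalars R k := dot (E B x) y.

(* The gauge may depend on the pair x, y.  A gauge valid for all x and y at
   once would, by scaling x, force all gauge-fine sums to be equal, which
   fails already for the identity function on [0, 1]. *)
Definition HK_operator (f : R -> scalars R k) (T : H -> H) : Prop :=
  bounded_operator T /\
  forall x y, HK_integral (real_spectrum A) (spectral_mu x y) f (dot (T x) y).

(* The operator f(A); the zero operator is only the default value required
   by xget. *)
Definition HK_calculus (f : R -> scalars R k) : H -> H :=
  xget (fun=> 0) [set T | HK_operator f T].

End functional_calculus.

(* Main.v *)
(* Write S_P(f) for the operator sum over j of f(t_j) E(C_j), P being a tagged
   partition of the spectrum K.  On a single P these sums are exactly linear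
   and multiplicative in f, send conj f to the adjoint of S_P(f) and 1 to the
   identity, so everything reduces to the strong convergence of S_P(f) along
   ever finer gauges.  A regulated f is within e of being constant between
   consecutive points of a finite set Q.  Hence two fine sums, written over
   their common refinement, have coefficients differing by at most e except
   on a punctured neighbourhood N of Q, where the difference is controlled by
   |E(N) x|; this tends to 0 as N shrinks to the empty set, so the sums are
   Cauchy.  Uniqueness of the integrals rests on Cousin's lemma for the
   compact set K, compactness of K on the Neumann series. *)
Require Import Defs.
From HB Require Import structures.
From mathcomp Require Import all_boot all_order all_algebra.
From mathcomp Require Import all_classical all_reals all_analysis.
From mathcomp Require Import measurable_realfun.
From mathcomp Require Import complex sesquilinear.
From mathcomp Require Import lra.

Import Order.TTheory GRing.Theory Num.Theory.
Import numFieldNormedType.Exports.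

Local Open Scope classical_set_scope.
Local Open Scope ring_scope.

Set Implicit Arguments.
Unset Strict Implicit.
Unset Printing Implicit Defensive.

(** * Scalars: conjugation, order and the embedding of the reals *)

Section scalars_theory.
Context (R : realType) (k : scalar_kind).
Local Notation F := (scalars R k).
Implicit Types z w : F.

Lemma scalar_conjD z w :
  scalar_conj (z + w) = scalar_conj z + scalar_conj w.
Proof. by case: k z w => //= z w; exact: raddfD. Qed.

Lemma scalar_conjN z : scalar_conj (- z) = - scalar_conj z.
Proof. by case: k z => //= z; exact: raddfN. Qed.

Lemma scalar_conjB z w :
  scalar_conj (z - w) = scalar_conj z - scalar_conj w.
Proof. by rewrite scalar_conjD scalar_conjN. Qed.

Lemma scalar_conj0 : scalar_conj (0 : F) = 0.
Proof. by rewrite -{1}(subrr 0) scalar_conjB subrr. Qed.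

Lemma scalar_conjK : involutive (@scalar_conj R k).
Proof. by case: k => //= z; exact: conjcK. Qed.

Lemma scalar_norm_conj z : `|scalar_conj z| = `|z|.
Proof. by case: k z => //= z; exact: normcJ. Qed.

Lemma of_realB (r s : R) : of_real k (r - s) = of_real k r - of_real k s.
Proof. by case: k => //=; exact: raddfB. Qed.

Lemma of_realM (r s : R) : of_real k (r * s) = of_real k r * of_real k s.
Proof. by case: k => //=; exact: rmorphM. Qed.

Lemma norm_of_real (r : R) : `|of_real k r| = of_real k `|r|.
Proof.
case: k => //=; by rewrite normc_def/= expr0n addr0 sqrtr_sqr.
Qed.

Lemma ler_of_real (r s : R) : (of_real k r <= of_real k s) = (r <= s).
Proof. by case: k => //=; exact: lecR. Qed.

Lemma ltr_of_real (r s : R) : (of_real k r < of_real k s) = (r < s).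
Proof. by case: k => //=; exact: ltcR. Qed.

Lemma of_real0 : of_real k (0 : R) = 0.
Proof. by case: k. Qed.

Lemma of_real_eq0 (r : R) : (of_real k r == 0) = (r == 0).
Proof. by rewrite -normr_le0 norm_of_real -of_real0 ler_of_real normr_le0. Qed.

(** In the order of [R[i]] only real numbers are comparable with 0, so norms and bounds, which are
    scalars, can be exchanged for elements of [R]. *)
Lemma scalar_ge0_real z : 0 <= z -> exists2 r : R, 0 <= r & z = of_real k r.
Proof.
case: k z => /= z z0; first by exists z.
have /complex_realP[r zr] := ger0_real z0.
by exists r => //; rewrite -ler0c -zr.
Qed.

Lemma scalar_archi z : exists n, `|z| < n%:R.
Proof.
have [r r0 ->] := scalar_ge0_real (normr_ge0 z).
exists (Num.truncn r).+1.
have -> : (Num.truncn r).+1%:R = of_real k (Num.truncn r).+1%:R :> F.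
  by case: k => //=; rewrite rmorph_nat.
by rewrite ltr_of_real truncnS_gt.
Qed.

Lemma scalar_cvg_half : (2^-1 : F) ^+ n @[n --> \oo] --> (0 : F).
Proof.
apply/cvgrPdist_lt => e e0.
have [N hN] := scalar_archi e^-1.
exists N => // n /= Nn; rewrite sub0r normrN normrX ger0_norm ?invr_ge0//.
rewrite exprVn invf_plt ?posrE ?exprn_gt0//.
have -> : e^-1 = `|e^-1| by rewrite gtr0_norm ?invr_gt0.
apply: (lt_le_trans hN); rewrite -natrX ler_nat.
by apply: (leq_trans Nn); rewrite ltnW// ltn_expl.
Qed.

End scalars_theory.

(** * The Neumann series *)

Section neumann.
Context (R : realType) (k : scalar_kind).
Local Notation F := (scalars R k).
Context (H : completeNormedModType F).

Lemma bounded_operatorP (T : H -> H) : bounded_operator T ->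
  exists2 M : F, 0 <= M & forall x, `|T x| <= M * `|x|.
Proof.
case=> _ [M hM]; exists `|M| => // x.
by rewrite -[leRHS]ger0_norm ?mulr_ge0// normrM !normr_id -[X in _ * X]normr_id
  -normrM ger0_norm// (le_trans _ (hM x)).
Qed.

(* x - B x = y is solved by iterating x |-> y + B x from 0. *)
Lemma neumann (B : H -> H) : linear B ->
  (forall x, `|B x| <= 2^-1 * `|x|) ->
  exists2 S, bounded_operator S &
    (forall x, S (x - B x) = x) /\ (forall x, S x - B (S x) = x).
Proof.
move=> linB hB.
have BB x y : B (x - y) = B x - B y.
  by rewrite addrC -scaleN1r linB scaleN1r addrC.
have inj x y : x - B x = y - B y -> x = y.
  move=> xy; have : x - y = B (x - y).
    by apply: subr0_eq; rewrite BB opprD addrACA xy -opprD subrr.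
  move=> xyE; have := hB (x - y); rewrite -xyE => h.
  apply/eqP; rewrite -subr_eq0 -normr_le0.
  by move: h; rewrite ler_pdivlMl// mulrDl mul1r gerDl.
have surj y : exists x, x - B x = y.
  pose u := fix u n := if n is m.+1 then y + B (u m) else 0.
  have du n : `|u n.+1 - u n| <= 2^-1 ^+ n * `|y|.
    elim: n => [|n IH].
      by rewrite /= subr0 -(subrr 0) BB subrr addr0 mul1r.
    rewrite [u n.+2]/= [u n.+1 in X in _ - X]/= opprD addrACA subrr add0r -BB.
    by rewrite (le_trans (hB _))// exprS -mulrA ler_wpM2l// invr_ge0.
  have du2 m n : `|u n - u (n + m)%N| <= 2 * (2^-1 ^+ n * `|y|).
    elim: m n => [|m IH] n.
      by rewrite addn0 subrr normr0 !mulr_ge0// exprn_ge0.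
    rewrite addnS -addSn (le_trans (ler_distD (u n.+1) _ _))//.
    rewrite mulrDl mul1r distrC lerD// (le_trans (IH _))//.
    by rewrite exprS !mulrA mulfV// mul1r.
  have : cvg (u n @[n --> \oo]).
    apply: cauchy_cvg; apply: cauchy_exP => e e0.
    have h : 2 * (2^-1 ^+ n * `|y|) @[n --> \oo] --> 2 * (0 * `|y|).
      by apply: cvgMr; apply: cvgMl; exact: scalar_cvg_half.
    rewrite mul0r mulr0 in h.
    have [N _ hN] := cvgr0_norm_lt _ h _ e0.
    exists (u N), N => // n /= Nn; rewrite -ball_normE /= -(subnKC Nn).
    rewrite (le_lt_trans (du2 _ _))//.
    have := hN N (leqnn _); rewrite /= ger0_norm// !mulr_ge0//.
  case/cvg_ex => x ux; exists x.
  have u1 : u n.+1 @[n --> \oo] --> x by move: ux; rewrite -(cvg_shiftS u).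
  have u2 : u n.+1 @[n --> \oo] --> y + B x.
    apply: cvgD; first exact: cvg_cst.
    apply/cvgrPdist_lt => e e0; move/cvgrPdist_lt : ux => /(_ _ e0).
    apply: filterS => n hn; rewrite -BB (le_lt_trans (hB _))//.
    by rewrite (le_lt_trans _ hn)// ler_piMl// invf_le1// ler1n.
  by rewrite [X in X - _](norm_cvg_unique u1 u2) addrK.
have [S hS] := choice surj.
exists S; last by split=> // x; apply: inj; rewrite hS.
split.
  (* Both sides have the same image under the injective map sending x to [x - B x]. *)
  move=> a x y; apply: inj; rewrite hS linB opprD addrACA -scalerBr !hS//.
(* In [S x = x + B (S x)] the last term has at most half the norm of [S x] and is absorbed on the
   left. *)
exists 2 => x.
have : `|S x| <= `|x| + 2^-1 * `|S x|.
  rewrite -{1}(subrK (B (S x)) (S x)) hS (le_trans (ler_normD _ _))// lerD//.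
rewrite -lerBlDr -{1}(mul1r `|S x|) -mulrBl.
have -> : 1 - 2^-1 = 2^-1 :> F by rewrite [X in X - _]splitr mul1r addrK.
by rewrite ler_pdivrMl.
Qed.

End neumann.

(** * Compactness of the real spectrum *)

Section real_spectrum_theory.
Context (R : realType) (k : scalar_kind).
Local Notation F := (scalars R k).
Context (H : completeNormedModType F) (A : H -> H).
Hypothesis bounded_A : bounded_operator A.

Lemma bounded_operator_comp (T S : H -> H) :
  bounded_operator T -> bounded_operator S -> bounded_operator (T \o S).
Proof.
move=> bT bS; have [M M0 hM] := bounded_operatorP bT.
have [N N0 hN] := bounded_operatorP bS.
split; first by move=> a x y /=; rewrite bS.1 bT.1.
by exists (M * N) => x; rewrite -mulrA (le_trans (hM _))// ler_wpM2l.
Qed.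

Lemma linear_subr (T : H -> H) x y : linear T -> T (x - y) = T x - T y.
Proof. by move=> lT; rewrite addrC -scaleN1r lT scaleN1r addrC. Qed.

Lemma linear_scaler (T : H -> H) a x : linear T -> T (a *: x) = a *: T x.
Proof.
move=> lT; rewrite -[a *: x]addr0 lT.
by rewrite -(subrr 0) linear_subr// subrr addr0.
Qed.

Lemma linear_sub_scale (T : H -> H) (l : F) :
  linear T -> linear (fun x => T x - l *: x).
Proof.
move=> lT a x y /=.
by rewrite lT scalerBr scalerDr !scalerA (mulrC l a) opprD addrACA.
Qed.

Lemma linear_scale (T : H -> H) (l : F) :
  linear T -> linear (fun x => l *: T x).
Proof. by move=> lT a x y; rewrite /= lT scalerDr !scalerA (mulrC l a). Qed.

(** If S inverts A - r, then A - s is (A - r)(1 - B) with B = (s - r) S, and 1 - B is invertible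
    once B has norm at most 1/2. *)
Lemma real_spectrumC_nbhs r : ~ real_spectrum A r ->
  exists2 d : R, 0 < d & forall s, `|s - r| < d -> ~ real_spectrum A s.
Proof.
rewrite /real_spectrum/= /spectrum/= => /contrapT[S bS [SK KS]].
have [M M0 hM] := bounded_operatorP bS.
have [m m0 mM] := scalar_ge0_real M0.
(* As [m] bounds S, this radius makes |s - r| m at most 1/2; the added 1 covers m = 0. *)
exists (2 * (m + 1))^-1 => [|s sr]; first by rewrite invr_gt0; lra.
apply; pose B x := of_real k (s - r) *: S x.
have linB : linear B by apply: linear_scale; exact: bS.1.
have hB x : `|B x| <= 2^-1 * `|x|.
  rewrite normrZ norm_of_real; apply: (le_trans (ler_wpM2l _ (hM x))).
    by rewrite -of_real0 ler_of_real.
  rewrite mM mulrA -of_realM ler_wpM2r//.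
  have -> : 2^-1 = of_real k (2^-1) :> F.
    by case: (k) => //=; rewrite rmorphV ?unitfE//= rmorph_nat.
  rewrite ler_of_real; have := normr_ge0 (s - r).
  move: sr; rewrite -div1r ltr_pdivlMr; lra.
have [N bN [NK KN]] := neumann linB hB.
have AE x : A x - of_real k s *: x =
    (fun x => A x - of_real k r *: x) (x - B x).
  rewrite (linear_subr _ _ (linear_sub_scale _ bounded_A.1)).
  rewrite (linear_scaler _ _ (linear_sub_scale _ bounded_A.1))/=.
  by have /= -> := KS x; rewrite of_realB scalerBl opprB addrA subrK.
exists (N \o S); first exact: bounded_operator_comp.
split=> x /=; last first.
  by rewrite AE KN (KS x).
by rewrite AE [S _](SK (x - B x)) NK.
Qed.

(** If |r| > 2m, where m bounds A, then A - r is -r (1 - A/r) and A/r has norm at most 1/2. *)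
Lemma real_spectrum_bounded :
  exists M, forall r, real_spectrum A r -> `|r| <= M.
Proof.
have [M M0 hM] := bounded_operatorP bounded_A.
have [m m0 mM] := scalar_ge0_real M0.
exists (2 * m) => r; apply: contraPP => /negP; rewrite -ltNge => mr; apply.
have r0 : of_real k r != 0.
  by rewrite of_real_eq0 -normr_gt0 (le_lt_trans _ mr)// mulr_ge0.
pose B x := (of_real k r)^-1 *: A x.
have linB : linear B by apply: linear_scale; exact: bounded_A.1.
have hB x : `|B x| <= 2^-1 * `|x|.
  rewrite normrZ normfV norm_of_real ler_pdivrMl ?mulrA; last first.
    by rewrite -of_real0 ltr_of_real (le_lt_trans _ mr)// mulr_ge0.
  apply: (le_trans (hM x)); rewrite ler_wpM2r// mM.
  have -> : 2^-1 = of_real k (2^-1) :> F.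
    by case: (k) => //=; rewrite rmorphV ?unitfE//= rmorph_nat.
  by rewrite -of_realM ler_of_real ler_pdivlMr// mulrC ltW.
have [N bN [NK KN]] := neumann linB hB.
have AE x : A x - of_real k r *: x = - of_real k r *: (x - B x).
  by rewrite scalerBr scalerA !mulNr mulfV// !scaleNr scale1r opprK addrC.
exists (fun x => - (of_real k r)^-1 *: N x).
  split; first by apply: linear_scale; exact: bN.1.
  have [L _ hL] := bounded_operatorP bN.
  exists (`|- (of_real k r)^-1| * L) => x.
  by rewrite normrZ -mulrA ler_wpM2l.
split=> x /=.
  by rewrite AE (linear_scaler _ _ bN.1) scalerA mulrNN mulVf// scale1r NK.
rewrite AE (linear_scaler _ _ linB) -scalerBr KN scalerA mulrNN mulfV//.
by rewrite scale1r.
Qed.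

Lemma closed_real_spectrum : closed (real_spectrum A).
Proof.
rewrite -openC openE => r /real_spectrumC_nbhs[d d0 hd].
by apply/nbhs_ballP; exists d => // s; rewrite /ball/= distrC => /hd.
Qed.

End real_spectrum_theory.

(** * Cousin's lemma for compact sets *)

Section cousin.
Context (R : realType).
Implicit Types (K : set R) (gamma : R -> R).

Lemma division_cell_rcons K p s C :
  division_cell K p C -> division_cell K (rcons p s) C.
Proof.
case=> i [b [c [ip ->]]]; exists i, b, c; rewrite size_rcons ltnS ltnW//.
by rewrite !nth_rcons ip (ltnW ip).
Qed.

(* Cousin's lemma is proved by real induction on s. *)
Definition partial_partition K gamma a s :=
  exists p (n : nat) (t : nat -> R) (C : nat -> set R),
  [/\ path <%R a p, last a p = s,
      forall j, (j < n)%N -> [/\ division_cell K (a :: p) (C j), C j (t j) &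
        C j `<=` `]t j - gamma (t j), t j + gamma (t j)[],
      forall i j u, (i < n)%N -> (j < n)%N -> C i u -> C j u -> i = j
    & forall u, (K u /\ u < s) <-> exists2 j, (j < n)%N & C j u].

(** Crosses a gap of K: the division gains a point but the partition no cell, since an empty cell
    could not contain its tag. *)
Lemma partial_partition_empty K gamma a s s' : s < s' ->
  (forall u, K u -> s <= u < s' -> False) ->
  partial_partition K gamma a s -> partial_partition K gamma a s'.
Proof.
move=> ss' Ks' [p [n [t [C [ap ps tC dC cC]]]]].
exists (rcons p s'), n, t, C; split=> //.
- by rewrite rcons_path ap ps.
- by rewrite last_rcons.
- move=> j /tC[? ? ?]; split=> //.
  by rewrite -rcons_cons; exact: division_cell_rcons.
- move=> u; rewrite -cC; split=> -[Ku us]; split=> //; last exact: lt_trans ss'.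
  by rewrite ltNge; apply/negP => su; apply: (Ks' u) => //; rewrite su.
Qed.

(** Adds one cell, the part of K in [s, s'), tagged at [u]. Half-open cells stay disjoint and match
    the strict bound [u < s] in [partial_partition]. *)
Lemma partial_partition_cell K gamma a s s' u : s <= u < s' -> K u ->
  (forall v, K v -> s <= v < s' -> u - gamma u < v < u + gamma u) ->
  partial_partition K gamma a s -> partial_partition K gamma a s'.
Proof.
move=> /andP[su us'] Ku Kg [p [n [t [C [ap ps tC dC cC]]]]].
have ss' := le_lt_trans su us'.
exists (rcons p s'), n.+1, (fun j => if j == n then u else t j),
  (fun j => if j == n then K `&` [set` Interval (BLeft s) (BLeft s')] else C j).
have Cn j v : (j < n)%N -> C j v -> v < s.
  by move=> jn Cv; have [|//] := (cC v).2; exists j.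
split=> //.
- by rewrite rcons_path ap ps.
- by rewrite last_rcons.
- move=> j; rewrite ltnS leq_eqVlt; case: eqVneq => [_ _|_ /= /tC[? ? ?]].
    split.
    (* The point s has index [size p] in [a :: p]; the sides [true, true] give [s, s'). *)
    + exists (size p), true, true; rewrite /= size_rcons; split=> //.
      rewrite nth_rcons ltnn eqxx -rcons_cons nth_rcons /= ltnSn.
      by rewrite -ps (last_nth 0).
    + by split=> //=; rewrite in_itv/= su.
    + by move=> v [Kv]/=; rewrite !in_itv/=; exact: Kg.
  by split=> //; rewrite -rcons_cons; exact: division_cell_rcons.
- move=> i j v; rewrite ltnS leq_eqVlt.
  case: (eqVneq i n) => [-> _|_ /= ilt]; rewrite ltnS leq_eqVlt.
    case: eqVneq => [->//|_ /= jlt] [_ /=].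
    rewrite in_itv/= => /andP[sv _] /(Cn _ _ jlt).
    by rewrite ltNge sv.
  case: eqVneq => [-> _|_ /= jlt].
  + move=> /(Cn _ _ ilt) vs [_ /=]; rewrite in_itv/= => /andP[sv _].
    by move: vs; rewrite ltNge sv.
  + exact: dC.
- move=> v; split=> [[Kv vs']|].
    have [sv|vs] := leP s v.
      by exists n => //; rewrite eqxx; split=> //=; rewrite in_itv/= sv.
    have [|j jn Cv] := (cC v).1; first by [].
    by exists j; rewrite ?ltnS 1?ltnW// (ltn_eqF jn).
  case=> j; rewrite ltnS leq_eqVlt; case: eqVneq => [_ _ [Kv]|_ /= jn Cv].
    by rewrite /= in_itv/= => /andP[].
  have [Kv vs] : K v /\ v < s by apply/cC; exists j.
  by split=> //; exact: lt_trans ss'.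
Qed.

(** The supremum [c] of the points reached cannot stop short of [b]: if c lies in K, a cell tagged
    at c leads past it; otherwise a gap of the closed set K around c does. *)
Lemma cousin K gamma : closed K -> (exists M, forall r, K r -> `|r| <= M) ->
  (forall t, K t -> 0 < gamma t) ->
  exists m (t : 'I_m -> R) (C : 'I_m -> set R),
    tagged_partition K t C /\ gauge_fine K gamma t C.
Proof.
(* [M] may be negative if K is empty, hence [|M|]; the margin 1 places K strictly between a and
   b. *)
move=> clK [M KM] g0; pose a := - `|M| - 1; pose b := `|M| + 1.
have Kab t : K t -> a < t < b.
  move=> /KM tM; rewrite /a /b -opprD -ltr_norml (le_lt_trans tM)//.
  by rewrite (le_lt_trans (ler_norm M))// ltrDl.
have ab : a <= b by rewrite /a /b; have := normr_ge0 M; lra.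
pose S := [set s | a <= s <= b /\ partial_partition K gamma a s].
have Sa : S a.
  split; first by rewrite lexx.
  exists [::], 0%N, (fun=> 0), (fun=> set0); split=> //= u.
  by split=> [[/Kab/andP[au _]]|[]//]; rewrite ltNge ltW.
have ubS : ubound S b by move=> s [/andP[]].
have hsS : has_sup S by split; [exists a|exists b].
pose c := sup S.
have cb : c <= b by apply: ge_sup => //; exists a.
have ac : a <= c by apply: ub_le_sup => //; exists b.
have approx d : 0 < d -> exists s, [/\ S s, c - d < s & s <= c].
  move=> d0; have [s Ss cs] := sup_adherent d0 hsS.
  by exists s; split=> //; apply: ub_le_sup => //; exists b.
have Pb : partial_partition K gamma a b.
  have [Kc|Kc] := pselect (K c).
    have /andP[_ cb'] := Kab _ Kc.
    have [s [[/andP[as_ sb] Ps] cs sc]] := approx _ (g0 _ Kc).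
    pose s' := Num.min b (c + gamma c / 2).
    have gc := g0 _ Kc.
    have cs' : c < s' by rewrite lt_min cb'; lra.
    have : S s'.
      split; first by rewrite (le_trans ac (ltW cs')) ge_min lexx.
      apply: (partial_partition_cell (u := c) _ _ _ Ps) => //.
        by rewrite sc.
      move=> v _ /andP[sv]; rewrite lt_min => /andP[_ vc].
      by apply/andP; split; lra.
    by move/(ub_le_sup (ex_intro _ b ubS)); rewrite leNgt cs'.
  have [d d0 hd] : exists2 d : R, 0 < d &
      forall v, K v -> c - d < v < c + d -> False.
    have := closed_openC clK; rewrite openE => /(_ _ Kc) /nbhs_ballP[d d0 hd].
    exists d => // v Kv vd; apply: (hd v) => //; rewrite /ball/= ltr_norml.
    by lra.
  have [s [[/andP[as_ sb] Ps] cs sc]] := approx _ d0.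
  pose s' := Num.min b (c + d / 2).
  have Ps' : partial_partition K gamma a s'.
    have : s <= s' by rewrite le_min sb; lra.
    rewrite le_eqVlt => /predU1P[<-//|ss'].
    apply: (partial_partition_empty ss' _ Ps) => v Kv /andP[sv].
    rewrite lt_min => /andP[_ vc]; apply: (hd v) => //; lra.
  (* This leaves only [b <= c], and then [s'] is [b] itself. *)
  have : s' <= c.
    apply: (ub_le_sup (ex_intro _ b ubS)); split=> //.
    by rewrite ge_min lexx /= le_min ab /=; lra.
  by rewrite ge_min => /orP[bc|]; [move: Ps'; rewrite /s' min_l//; lra|lra].
have [p [n [t [C [ap pb tC dC cC]]]]] := Pb.
exists n, (fun j => t j), (fun j => C j); split; last first.
  move=> j; have [dj _ Cj] := tC j (ltn_ord j).
  move=> u Cu; split; first exact: Cj.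
  by have [] := (cC u).2; first exists j.
split.
- exists (a :: p); last by move=> j; have [] := tC j (ltn_ord j).
  split=> // u /Kab; rewrite /= -/(nth 0 (a :: p) (size p)).
  by rewrite -(last_nth 0 a p) -?(last_nth a) pb.
- apply/seteqP; split=> [u [j _ Cu]|u Ku].
    by have [] := (cC u).2; first exists j.
  have [|j jn Cu] := (cC u).1; first by have /andP[] := Kab _ Ku.
  by exists (Ordinal jn).
- move=> i j _ _ [u [Ci Cj]]; apply: val_inj.
  exact: (dC _ _ u (ltn_ord i) (ltn_ord j) Ci Cj).
- move=> i j; split=> [Ct|->]; last by have [] := tC j (ltn_ord j).
  apply: val_inj; apply: (dC _ _ (t j) (ltn_ord i) (ltn_ord j) Ct).
  by have [] := tC j (ltn_ord j).
Qed.

End cousin.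

(** * Inner product geometry *)

Section inner_product.
Context (R : realType) (k : scalar_kind).
Local Notation F := (scalars R k).
Context (H : completeNormedModType F) (dot : {dot H for @scalar_conj R k}).
Hypothesis norm_dot : forall x : H, `|x| ^+ 2 = dot x x.
Implicit Types x y : H.

Lemma dot_conj x y : dot y x = scalar_conj (dot x y).
Proof.
by rewrite (hermitian_subproof (s := dot)) expr0 mul1r.
Qed.

Lemma dot_orthoC x y : dot x y = 0 -> dot y x = 0.
Proof. by move=> xy; rewrite dot_conj xy scalar_conj0. Qed.

Lemma dotZr a x y : dot x (a *: y) = scalar_conj a * dot x y.
Proof. by rewrite linearZr_LR. Qed.

Lemma dotZl a x y : dot (a *: x) y = a * dot x y.
Proof. by rewrite linearZl_LR. Qed.

Lemma dot_inj x y : (forall z, dot x z = dot y z) -> x = y.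
Proof.
move=> xy; apply/eqP; rewrite -subr_eq0 -normr_eq0 -sqrf_eq0 norm_dot.
by rewrite linearBl/= xy subrr.
Qed.

Lemma pythagoras x y : dot x y = 0 -> `|x + y| ^+ 2 = `|x| ^+ 2 + `|y| ^+ 2.
Proof.
move=> xy; rewrite !norm_dot linearDl !linearDr/= xy (dot_orthoC xy).
by rewrite addr0 add0r.
Qed.

Lemma norm_sum_ortho (I : finType) (v : I -> H) :
  (forall i j, i != j -> dot (v i) (v j) = 0) ->
  `|\sum_i v i| ^+ 2 = \sum_i `|v i| ^+ 2.
Proof.
move=> ov; rewrite norm_dot linear_sumlz; apply: eq_bigr => i _.
rewrite linear_sumr/= (bigD1 i)//= big1 ?addr0 -?norm_dot//.
by move=> j ji; rewrite ov// eq_sym.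
Qed.

(** [a *: y] is the orthogonal projection of x on the line of y, hence no longer than x by
    Pythagoras. *)
Lemma cauchy_schwarz x y : `|dot x y| <= `|x| * `|y|.
Proof.
have [->|y0] := eqVneq y 0; first by rewrite linear0r normr0 mulr_ge0.
have n0 : 0 < `|y| ^+ 2 by rewrite exprn_gt0// normr_gt0.
pose a := dot x y / `|y| ^+ 2; pose u := x - a *: y.
have uy : dot u (a *: y) = 0.
  by rewrite dotZr linearBl/= dotZl -norm_dot divfK ?gt_eqF// subrr mulr0.
have : `|a *: y| ^+ 2 <= `|x| ^+ 2.
  by rewrite -[in leRHS](subrK (a *: y) x) (pythagoras uy) lerDr exprn_ge0.
rewrite ler_sqr ?nnegrE// normrZ normrM normfV (ger0_norm (ltW n0)).
rewrite expr2 invfM !mulrA divfK ?normr_eq0//.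
by rewrite ler_pdivrMr// normr_gt0.
Qed.

Lemma cvg_dotl (T : Type) (G : set_system T) {FG : Filter G} (u : T -> H) x y :
  u t @[t --> G] --> x -> dot (u t) y @[t --> G] --> dot x y.
Proof.
move=> /cvgrPdist_lt ux; apply/cvgrPdist_lt => e e0.
(* Adding 1 keeps the denominator positive when y is 0; the same device recurs in later
   estimates. *)
have d0 : 0 < e / (`|y| + 1) by rewrite divr_gt0// ltr_pwDr.
apply: filterS (ux _ d0) => t; rewrite ltr_pdivlMr ?ltr_pwDr// => h.
rewrite -linearBl/= (le_lt_trans (cauchy_schwarz _ _))//.
by rewrite (le_lt_trans _ h)// ler_wpM2l// lerDl.
Qed.

Lemma cvg_dotr (T : Type) (G : set_system T) {FG : Filter G} (u : T -> H) x y :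
  u t @[t --> G] --> y -> dot x (u t) @[t --> G] --> dot x y.
Proof.
move=> /(cvg_dotl (y := x))/cvgrPdist_lt ux; apply/cvgrPdist_lt => e /ux.
apply: filterS => t.
rewrite [dot x y]dot_conj [dot x (u t)]dot_conj -scalar_conjB.
by rewrite scalar_norm_conj.
Qed.

End inner_product.

(** * Projection-valued measures: norm bounds, finite additivity, continuity from above *)

Section projection_valued_measure_theory.
Context (R : realType) (k : scalar_kind).
Local Notation F := (scalars R k).
Context (H : completeNormedModType F) (dot : {dot H for @scalar_conj R k}).
Hypothesis norm_dot : forall x : H, `|x| ^+ 2 = dot x x.
Context (K : set R) (E : set R -> H -> H).
Hypothesis pvmE : projection_valued_measure dot K E.
Implicit Types (B C : set R) (x y : H).

Lemma borel_inI B C : borel_in K B -> borel_in K C -> borel_in K (B `&` C).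
Proof.
by move=> [mB BK] [mC _]; split; [exact: measurableI|move=> s [/BK]].
Qed.

Lemma borel_inD B C : borel_in K B -> borel_in K C -> borel_in K (B `\` C).
Proof.
by move=> [mB BK] [mC _]; split; [exact: measurableD|move=> s [/BK]].
Qed.

Lemma borel_in0 : borel_in K set0.
Proof. by split; [exact: measurable0|exact: sub0set]. Qed.

Lemma pvm_linear B : borel_in K B -> linear (E B).
Proof. by move=> bB; have [/(_ _ bB)[[lE _] _ _] _ _ _] := pvmE. Qed.

Lemma pvm0 x : E set0 x = 0.
Proof. by have [_ [-> _] _ _] := pvmE. Qed.

Lemma pvmK x : E K x = x.
Proof. by have [_ [_ ->] _ _] := pvmE. Qed.

Lemma pvmI B C x : borel_in K B -> borel_in K C ->
  E (B `&` C) x = E B (E C x).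
Proof. by move=> bB bC; have [_ _ h _] := pvmE; rewrite h. Qed.

Lemma pvm_self_adjoint B x y : borel_in K B -> dot (E B x) y = dot x (E B y).
Proof. by move=> bB; have [/(_ _ bB)[_ _ ->] _ _ _] := pvmE. Qed.

Lemma pvm_idem B x : borel_in K B -> E B (E B x) = E B x.
Proof. by move=> bB; rewrite -pvmI// setIid. Qed.

Lemma pvm_ortho B C x y : borel_in K B -> borel_in K C -> B `&` C = set0 ->
  dot (E B x) (E C y) = 0.
Proof.
move=> bB bC BC; rewrite pvm_self_adjoint// -pvmI// BC pvm0.
by rewrite linear0r.
Qed.

(* Bessel's inequality gives the bound, the vectors E (B i) x being
   pairwise orthogonal. *)
Lemma norm_pvm_sum (I : finType) (B : I -> set R) (a : I -> F) (c : F) x :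
  0 <= c -> (forall i, borel_in K (B i)) ->
  (forall i j, i != j -> B i `&` B j = set0) ->
  (forall i, B i !=set0 -> `|a i| <= c) ->
  `|\sum_i a i *: E (B i) x| <= c * `|x|.
Proof.
move=> c0 bB dB aB.
have ortho i j : i != j -> dot (E (B i) x) (E (B j) x) = 0.
  by move=> ij; rewrite pvm_ortho// dB.
have bessel : \sum_i `|E (B i) x| ^+ 2 <= `|x| ^+ 2.
  pose s := \sum_i E (B i) x.
  have Ns : `|s| ^+ 2 = \sum_i `|E (B i) x| ^+ 2 by exact: norm_sum_ortho.
  (* [s] is the projection of x on the sum of the orthogonal ranges, so [x - s] is orthogonal to
     [s]. *)
  have sx : dot s x = `|s| ^+ 2.
    rewrite Ns linear_sumlz; apply: eq_bigr => i _.
    by rewrite norm_dot -[in RHS]pvm_self_adjoint ?pvm_idem.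
  have sxs : dot s (x - s) = 0 by rewrite linearBr/= sx -norm_dot subrr.
  rewrite -Ns -[in leRHS](subrK s x) addrC (pythagoras norm_dot)//.
  by rewrite lerDl exprn_ge0.
rewrite -ler_sqr ?nnegrE ?mulr_ge0// (norm_sum_ortho norm_dot)//; last first.
  by move=> i j ij; rewrite dotZl dotZr ortho// !mulr0.
rewrite exprMn; apply: le_trans (ler_wpM2l _ bessel); last exact: exprn_ge0.
rewrite mulr_sumr; apply: ler_sum => i _; rewrite normrZ exprMn.
(* [E set0] is zero, so coefficients on empty sets may be arbitrary. *)
have [Bi|/nonemptyPn Bi] := pselect (B i !=set0).
  by rewrite ler_wpM2r ?exprn_ge0// ler_sqr ?nnegrE// aB.
by rewrite Bi pvm0 normr0 expr0n/= !mulr0.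
Qed.

(** Countable additivity is applied to the family padded with empty sets, whose partial sums are
    constant from [#|I|] on. *)
Lemma pvm_additive (I : finType) (B : I -> set R) x :
  (forall i, borel_in K (B i)) ->
  (forall i j, i != j -> B i `&` B j = set0) ->
  E (\bigcup_i B i) x = \sum_i E (B i) x.
Proof.
move=> bB dB.
pose B' n := if insub n is Some j then B (enum_val (j : 'I_#|I|)) else set0.
have bB' n : borel_in K (B' n).
  by rewrite /B'; case: insub => [j|]; [exact: bB|exact: borel_in0].
have dB' : trivIset setT B'.
  move=> i j _ _; rewrite /B'.
  case: insubP => [i' _ <-|_ [u []//]]; case: insubP => [j' _ <-|_ [u []//]].
  move=> [u [Bi Bj]]; suff -> : i' = j' by []; apply/enum_val_inj/eqP.
  by apply: contraPT Bi => /dB Bd Bi; have : (set0 : set R) u by rewrite -Bd.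
have UB : \bigcup_n B' n = \bigcup_i B i.
  apply/seteqP; split=> u [n _].
    by rewrite /B'; case: insub => // j Bu; exists (enum_val j).
  move=> Bu; exists (enum_rank n) => //.
  by rewrite /B' valK enum_rankK.
have [_ _ _ /(_ _ bB' dB' x)] := pvmE; rewrite UB => cE.
have cS : \sum_(0 <= i < n) E (B' i) x @[n --> \oo] --> \sum_i E (B i) x.
  apply: cvg_near_cst; exists #|I| => // n /= In.
  rewrite (big_cat_nat (leq0n _) In)/= [X in _ + X]big_nat.
  rewrite [X in _ + X]big1 ?addr0; last first.
    by move=> i /andP[iI _]; rewrite /B' insubN ?pvm0// -leqNgt.
  rewrite big_mkord [RHS](reindex _ (onW_bij _ (@enum_val_bij I)))/=.
  by apply: eq_bigr => i _; rewrite /B' valK.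
exact: norm_cvg_unique cE cS.
Qed.

Lemma pvmU B C x : borel_in K B -> borel_in K C -> B `&` C = set0 ->
  E (B `|` C) x = E B x + E C x.
Proof.
move=> bB bC BC; have := @pvm_additive bool (fun b => if b then B else C) x.
rewrite big_bool/= => <-; last 2 first.
- by case.
- by case=> -[]//= _; rewrite setIC.
congr (E _ x); apply/seteqP; split=> u.
  by case; [exists true|exists false].
by case=> -[] _; [left|right].
Qed.

(** Continuity from above: [N 0] is the disjoint union of the layers [B n], so [E (N n) x] is the
    tail of a convergent series. *)
Lemma pvm_decreasing (N : nat -> set R) x : (forall n, borel_in K (N n)) ->
  (forall n, N n.+1 `<=` N n) -> \bigcap_n N n = set0 ->
  E (N n) x @[n --> \oo] --> (0 : H).
Proof.
move=> bN dN N0; pose B n := N n `\` N n.+1.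
have bB n : borel_in K (B n) by exact: borel_inD.
have mono m n : (m <= n)%N -> N n `<=` N m.
  elim: n => [|n IH]; first by rewrite leqn0 => /eqP ->.
  rewrite leq_eqVlt => /predU1P[->//|]; rewrite ltnS => mn u /dN; exact: IH.
have NB n : E (N n) x = E (B n) x + E (N n.+1) x.
  by rewrite -pvmU ?setDKI// ?setDKU// setIC setDIK.
have dB : trivIset setT B.
  apply: ltn_trivIset => n m nm.
  apply/seteqP; split=> u // [[_ nN] [Nn _]]; apply: nN.
  exact: (mono _ _ nm _ Nn).
have UB : \bigcup_n B n = N 0%N.
  apply/seteqP; split=> u.
    by case=> n _ [Nn _]; exact: (mono 0%N n (leq0n n)).
  move=> N0u; apply: contrapT => nB.
  have : (\bigcap_n N n) u.
    move=> n _; elim: n => // n Nn; apply: contrapT => nN.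
    by apply: nB; exists n.
  by rewrite N0.
have [_ _ _ /(_ _ bB dB x)] := pvmE; rewrite UB => cE.
have SE n : E (N n) x = E (N 0%N) x - \sum_(0 <= i < n) E (B i) x.
  elim: n => [|n IH]; first by rewrite big_geq// subr0.
  by rewrite big_nat_recr//= opprD addrA -IH (NB n) addrAC subrr add0r.
rewrite (_ : (fun n => _) = fun n => E (N 0%N) x - \sum_(0 <= i < n) E (B i) x).
  rewrite -[X in _ --> X](subrr (E (N 0%N) x)).
  by apply: cvgB cE; exact: cvg_cst.
exact/funext.
Qed.

End projection_valued_measure_theory.

(** * Henstock-Kurzweil integrals as limits along a filter *)

Section HK_filter.
Context (R : realType).
Implicit Types (K : set R) (gamma : R -> R).

(** The number of cells is bundled in, so that families of all sizes form one type carrying a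
    filter. *)
Definition tagged_family := {m : nat & (('I_m -> R) * ('I_m -> set R))%type}.

(* Being gauge-fine for ever smaller gauges is a filter, proper by Cousin's
   lemma, so that Henstock-Kurzweil integrals are limits along it. *)
Definition HK_filter K : set_system tagged_family :=
  [set S | exists2 gamma : R -> R, (forall t, K t -> 0 < gamma t) &
    forall m (t : 'I_m -> R) (C : 'I_m -> set R),
      tagged_partition K t C -> gauge_fine K gamma t C ->
      S (existT _ m (t, C))].

Lemma gauge_fineP K gamma m (t : 'I_m -> R) (C : 'I_m -> set R) :
  gauge_fine K gamma t C <-> forall j s, C j s ->
    t j - gamma (t j) < s < t j + gamma (t j) /\ K s.
Proof.
split=> fC j s /fC[h Ks]; split=> //.
Qed.

Lemma gauge_fine_le K gamma gamma' m (t : 'I_m -> R) (C : 'I_m -> set R) :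
  (forall s, gamma s <= gamma' s) -> gauge_fine K gamma t C ->
  gauge_fine K gamma' t C.
Proof.
move=> gg' /gauge_fineP fC; apply/gauge_fineP => j s /fC[h Ks].
by split=> //; have := gg' (t j); lra.
Qed.

Global Instance HK_filter_filter K : Filter (HK_filter K).
Proof.
split.
- by exists (fun=> 1).
- move=> S S' [g g0 Sg] [g' g'0 Sg'].
  exists (fun t => Num.min (g t) (g' t)) => [t Kt|m t C PC fC].
    by rewrite lt_min g0// g'0.
  by split; [apply: Sg|apply: Sg'] => //; apply: gauge_fine_le fC => s;
    rewrite ge_min lexx ?orbT.
- by move=> S S' SS' [g g0 Sg]; exists g => // m t C PC /(Sg _ _ _ PC)/SS'.
Qed.

Lemma HK_filter_proper K : closed K ->
  (exists M, forall r, K r -> `|r| <= M) -> ProperFilter (HK_filter K).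
Proof.
move=> clK bK; apply: Build_ProperFilter_ex => S [g g0 Sg].
have [m [t [C [PC fC]]]] := cousin clK bK g0.
by exists (existT _ m (t, C)); exact: Sg.
Qed.

Lemma HK_filter_partition K gamma : (forall t, K t -> 0 < gamma t) ->
  \forall P \near HK_filter K, tagged_partition K (projT2 P).1 (projT2 P).2 /\
    gauge_fine K gamma (projT2 P).1 (projT2 P).2.
Proof. by move=> g0; exists gamma. Qed.

Lemma HK_integralP (F : numFieldType) K (mu : set R -> F) (f : R -> F) (I : F) :
  HK_integral K mu f I <->
  HK_sum f mu (projT2 P).1 (projT2 P).2 @[P --> HK_filter K] --> I.
Proof.
split=> [fI|/cvgrPdist_lt fI e /fI [g g0 Sg]].
  apply/cvgrPdist_lt => e /fI [g g0 Sg].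
  by exists g => // m t C PC fC /=; rewrite distrC; exact: Sg.
by exists g => // m t C PC fC; rewrite distrC; exact: Sg fC.
Qed.

End HK_filter.

(** * Regulated functions on a compact set *)

Section regulated_functions.
Context (R : realType) (F : numFieldType) (K : set R).
Hypotheses (closedK : closed K)
  (boundedK : exists M, forall r, K r -> `|r| <= M).
Implicit Types f : R -> F.

Lemma regulated_nbhs f t e : regulated K f -> K t -> 0 < e ->
  exists (d : R) (l l' : F), 0 < d /\ forall s, K s ->
    (t - d < s < t -> `|f s - l| < e) /\ (t < s < t + d -> `|f s - l'| < e).
Proof.
move=> rf Kt e0; have [[l fl] [l' fl']] := rf t Kt.
move/cvgrPdist_lt/(_ _ e0) : fl => /nbhs_ballP[d1 d10 h1].
move/cvgrPdist_lt/(_ _ e0) : fl' => /nbhs_ballP[d2 d20 h2].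
exists (Num.min d1 d2), l, l'; split; first by rewrite lt_min d10.
have m1 : Num.min d1 d2 <= d1 by rewrite ge_min lexx.
have m2 : Num.min d1 d2 <= d2 by rewrite ge_min lexx orbT.
move=> s Ks; split=> /andP[st ts]; rewrite distrC.
  by apply: h1; rewrite /ball/= ?ltr_norml//; lra.
by apply: h2; rewrite /ball/= ?ltr_norml//; lra.
Qed.

(** With a gauge of local boundedness, Cousin's lemma leaves finitely many tags whose neighbourhoods
    cover K; the sum of their local bounds is a global one. *)
Lemma regulated_bounded f : regulated K f ->
  exists2 M, 0 <= M & forall s, K s -> `|f s| <= M.
Proof.
move=> rf.
have /choice[g hg] t : exists dM : R * F, K t -> [/\ 0 < dM.1, 0 <= dM.2 &
    forall s, K s -> t - dM.1 < s < t + dM.1 -> `|f s| <= dM.2].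
  have [Kt|Kt] := pselect (K t); last by exists (0, 0).
  have [d [l [l' [d0 h]]]] := regulated_nbhs rf Kt ltr01.
  (* The three terms serve t itself, its left side and its right side. *)
  exists (d, `|f t| + (1 + `|l|) + (1 + `|l'|)) => _; split=> //.
    by rewrite !addr_ge0.
  move=> s Ks /= /andP[ds sd]; have [hl hr] := h s Ks.
  have le z : `|f s - z| < 1 -> `|f s| <= 1 + `|z|.
    move=> fz; rewrite -[in leLHS](subrK z (f s)).
    by rewrite (le_trans (ler_normD _ _))// lerD2r ltW.
  have [st|ts|->] := ltgtP s t.
  - rewrite (le_trans (le l _)) ?hl ?ds//.
    by rewrite -addrA addrCA lerDl addr_ge0// addr_ge0.
  - by rewrite (le_trans (le l' _)) ?hr ?ts// lerDr addr_ge0// addr_ge0.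
  - by rewrite -addrA lerDl addr_ge0// addr_ge0.
have g0 t : K t -> 0 < (g t).1 by move=> /hg[].
have [m [t [C [[_ UC _ tC] fC]]]] := cousin closedK boundedK g0.
have CK j s : C j s -> K s by move=> Cs; rewrite -UC; exists j.
have Kt j : K (t j) by apply: (CK j); apply/tC.
exists (\sum_j (g (t j)).2) => [|s].
  by apply: sumr_ge0 => j _; have [] := hg _ (Kt j).
rewrite -UC => -[j _ Cs]; have [_ M0 h] := hg _ (Kt j).
rewrite (bigD1 j)//= (le_trans (h s _ _)) ?lerDl//; [exact: CK Cs| |].
- by have [] := (gauge_fineP _ _ _ _).1 fC j s Cs.
- by apply: sumr_ge0 => i _; have [] := hg _ (Kt i).
Qed.

(** Take a partition fine for a gauge within which f stays e/2 close to its one-sided limits. Two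
    points on the same side of all division points and tags share a cell and, being on one side of
    its tag, are close to the same one-sided limit. *)
Lemma regulated_gaps f e : regulated K f -> 0 < e ->
  exists Q : seq R, forall s s', K s -> K s' ->
    (forall q, q \in Q -> (q < s) && (q < s') || (s < q) && (s' < q)) ->
    `|f s - f s'| <= e.
Proof.
move=> rf e0; have e20 : 0 < e / 2 by rewrite divr_gt0.
have /choice[g hg] t : exists d : R, K t -> 0 < d /\ forall s s', K s -> K s' ->
    t - d < s < t + d -> t - d < s' < t + d ->
    (t < s) && (t < s') || (s < t) && (s' < t) -> `|f s - f s'| <= e.
  have [Kt|Kt] := pselect (K t); last by exists 0.
  have [d [l [l' [d0 h]]]] := regulated_nbhs rf Kt e20.
  exists d => _; split=> // s s' Ks Ks' /andP[ds sd] /andP[ds' sd'].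
  have [hl hr] := h s Ks; have [hl' hr'] := h s' Ks'.
  have le z : `|f s - z| < e / 2 -> `|f s' - z| < e / 2 -> `|f s - f s'| <= e.
    move=> h1 h2; rewrite (le_trans (ler_distD z _ _))//.
    by rewrite [leRHS]splitr lerD// ltW// distrC.
  case/orP => /andP[st st'].
    by apply: (le l'); [apply: hr|apply: hr']; rewrite ?st ?st'.
  by apply: (le l); [apply: hl|apply: hl']; rewrite ?st ?st' ?andbT.
have g0 t : K t -> 0 < g t by move=> /hg[].
have [m [t [C [[[p [_ _ _] pC] UC _ tC] fC]]]] := cousin closedK boundedK g0.
have CK j s : C j s -> K s by move=> Cs; rewrite -UC; exists j.
have Kt j : K (t j) by apply: (CK j); apply/tC.
exists (p ++ codom t) => s s' Ks Ks' sep.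
move: (Ks); rewrite -UC => -[j _ Cs].
(* [s'] lies strictly between the ends of the cell, whichever of these belong to it. *)
have Cs' : C j s'.
  have [i [b [c [ip CE]]]] := pC j.
  move: Cs; rewrite CE => -[_ Is].
  have : s \in Interval (BSide b p`_i) (BSide c p`_i.+1) := Is.
  rewrite in_itv => /andP[ps sp].
  have {}ps : p`_i <= s by move: ps; case: (b) => //= /ltW.
  have {}sp : s <= p`_i.+1 by move: sp; case: (c) => //= /ltW.
  split=> //; rewrite /= in_itv/=.
  have h1 : p`_i < s'.
    have := sep p`_i; rewrite mem_cat mem_nth ?(ltnW ip)// => /(_ isT).
    by rewrite (ltNge s) ps/= orbF => /andP[].
  have h2 : s' < p`_i.+1.
    have := sep p`_i.+1; rewrite mem_cat mem_nth// => /(_ isT).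
    by rewrite (ltNge _ s) sp/= => /andP[].
  by apply/andP; split; [move: (b)|move: (c)] => -[] //=; rewrite ?ltW.
have [_ h] := hg _ (Kt j).
have fine u : C j u -> t j - g (t j) < u < t j + g (t j).
  by move=> Cu; have [] := (gauge_fineP _ _ _ _).1 fC j u Cu.
by apply: h; rewrite ?fine//; apply: sep; rewrite mem_cat codom_f orbT.
Qed.

End regulated_functions.

(** * Closure of the regulated functions under algebra operations and conjugation *)

Section regulated_closure.
Context (R : realType) (k : scalar_kind) (K : set R).
Local Notation F := (scalars R k).
Implicit Types f g : R -> F.

Lemma regulated_cst (c : F) : regulated K (fun=> c).
Proof. by move=> t _; split; exists c; exact: cvg_cst. Qed.

Lemma regulatedD f g : regulated K f -> regulated K g ->
  regulated K (fun t => f t + g t).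
Proof.
move=> rf rg t Kt; have [[a fa] [b fb]] := rf t Kt.
have [[a' ga] [b' gb]] := rg t Kt.
by split; [exists (a + a')|exists (b + b')]; exact: cvgD.
Qed.

Lemma regulatedM f g : regulated K f -> regulated K g ->
  regulated K (fun t => f t * g t).
Proof.
move=> rf rg t Kt; have [[a fa] [b fb]] := rf t Kt.
have [[a' ga] [b' gb]] := rg t Kt.
by split; [exists (a * a')|exists (b * b')]; exact: cvgM.
Qed.

Lemma regulated_conj f : regulated K f ->
  regulated K (fun t => scalar_conj (f t)).
Proof.
have cvg_conj G (FG : Filter G) (u : R -> F) a :
    u t @[t --> G] --> a -> scalar_conj (u t) @[t --> G] --> scalar_conj a.
  move=> /cvgrPdist_lt ua; apply/cvgrPdist_lt => e /ua.
  by apply: filterS => t; rewrite -scalar_conjB scalar_norm_conj.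
move=> rf t Kt; have [[a fa] [b fb]] := rf t Kt.
by split; [exists (scalar_conj a)|exists (scalar_conj b)]; exact: cvg_conj.
Qed.

End regulated_closure.

(** * Punctured neighbourhoods of finite sets *)

Section punctured_neighborhoods.
Context (R : realType).
Implicit Types (Q : seq R) (d : R).

(** Provides the gauge that keeps a cell tagged at t away from the other points of Q. *)
Lemma seq_separated Q t :
  exists2 d, 0 < d & forall q, q \in Q -> q != t -> d <= `|q - t|.
Proof.
elim: Q => [|q Q [d d0 h]]; first by exists 1.
have [qt|qt] := eqVneq q t.
  by exists d => // r; rewrite inE => /predU1P[->|/h//]; rewrite qt eqxx.
exists (Num.min d `|q - t|); first by rewrite lt_min d0 normr_gt0 subr_eq0.
move=> r; rewrite inE ge_min => /predU1P[->|/h{}h /h->//].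
by rewrite lexx orbT.
Qed.

(** Each interval omits its own centre, as E may charge single points: only so do the neighbourhoods
    shrink to the empty set. *)
Definition punctured Q d : set R :=
  \bigcup_(q in [set` Q]) (`]q - d, q + d[ `\ q).

Lemma puncturedP Q d q s : q \in Q -> s != q -> q - d < s < q + d ->
  punctured Q d s.
Proof.
move=> qQ sq qds; exists q => //; split; last exact/eqP.
by rewrite /= in_itv.
Qed.

Lemma measurable_punctured Q d :
  measurable (punctured Q d : set (measurableTypeR R)).
Proof.
apply: fin_bigcup_measurable => [|q _]; first exact: finite_seq.
by apply: measurableD; [exact: measurable_itv|exact: measurable_set1].
Qed.

Lemma punctured_le Q d d' : d <= d' -> punctured Q d `<=` punctured Q d'.
Proof.
move=> dd' s [q qQ [sq s_q]]; exists q => //; split=> //.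
move: sq; rewrite /= !in_itv/= => /andP[h1 h2].
by apply/andP; split; lra.
Qed.

Lemma punctured_bigcap Q : \bigcap_n punctured Q n.+1%:R^-1 = set0.
Proof.
apply/seteqP; split=> // s sP.
have [d d0 h] := seq_separated Q s.
(* This index makes the radius smaller than [d], a lower bound for the distances from s to the other
   points of Q. *)
have [q qQ [sq s_q]] := sP (Num.truncn d^-1) I.
have := h q qQ; rewrite eq_sym => /(_ (introN eqP s_q)) dq.
have n1 : (Num.truncn d^-1).+1%:R^-1 < d.
  by rewrite invf_plt ?posrE// truncnS_gt.
move: n1 sq; rewrite /= in_itv/=; move: (_^-1) => e ed qs.
have : `|q - s| < e by rewrite ltr_norml; lra.
by rewrite ltNge (le_trans (ltW ed)).
Qed.

End punctured_neighborhoods.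

(** * Operator-valued Riemann sums *)

Section operator_sums.
Context (R : realType) (k : scalar_kind).
Local Notation F := (scalars R k).
Context (H : completeNormedModType F) (dot : {dot H for @scalar_conj R k}).
Hypothesis norm_dot : forall x : H, `|x| ^+ 2 = dot x x.
Context (K : set R) (E : set R -> H -> H).
Hypotheses (closedK : closed K)
  (boundedK : exists M, forall r, K r -> `|r| <= M).
Hypothesis pvmE : projection_valued_measure dot K E.
Implicit Types (f g : R -> F) (x y : H) (P : tagged_family R).

Definition operator_sum f P x : H :=
  \sum_(j < projT1 P) f ((projT2 P).1 j) *: E ((projT2 P).2 j) x.

Lemma borel_in_self : borel_in K K.
Proof. by split=> //; exact: closed_measurable. Qed.

Lemma tagged_partition_borel m (t : 'I_m -> R) (C : 'I_m -> set R) :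
  tagged_partition K t C -> forall j, borel_in K (C j).
Proof.
case=> [[p _ pC] _ _ _] j; have [i [b [c [_ ->]]]] := pC j.
split; last by move=> s [].
by apply: measurableI; [exact: borel_in_self.1|exact: measurable_itv].
Qed.

Lemma tagged_partition_disjoint m (t : 'I_m -> R) (C : 'I_m -> set R) :
  tagged_partition K t C -> forall i j, i != j -> C i `&` C j = set0.
Proof.
case=> [_ _ tC _] i j ij; apply/eqP; apply: contraNT ij => /set0P Cij.
by apply/eqP; exact: tC.
Qed.

Lemma tagged_partition_tag m (t : 'I_m -> R) (C : 'I_m -> set R) :
  tagged_partition K t C -> forall j, K (t j).
Proof. by case=> [_ <- _ tC] j; exists j => //; apply/tC. Qed.

Lemma operator_sum_linear f m (t : 'I_m -> R) (C : 'I_m -> set R) :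
  tagged_partition K t C -> linear (operator_sum f (existT _ m (t, C))).
Proof.
move=> PC a x y; rewrite /operator_sum/= scaler_sumr -big_split/=.
apply: eq_bigr => j _.
rewrite (pvm_linear pvmE (tagged_partition_borel PC j)) scalerDr !scalerA.
by rewrite (mulrC a).
Qed.

Lemma norm_operator_sum f M m (t : 'I_m -> R) (C : 'I_m -> set R) x :
  0 <= M -> (forall s, K s -> `|f s| <= M) -> tagged_partition K t C ->
  `|operator_sum f (existT _ m (t, C)) x| <= M * `|x|.
Proof.
move=> M0 fM PC; apply: (norm_pvm_sum norm_dot pvmE) => //.
- exact: tagged_partition_borel PC.
- exact: tagged_partition_disjoint PC.
- by move=> j _; apply: fM; exact: (tagged_partition_tag PC).
Qed.

(** The projections of distinct cells annihilate each other, so the double sum collapses to its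
    diagonal, where they are idempotent. *)
Lemma operator_sumM f g m (t : 'I_m -> R) (C : 'I_m -> set R) x :
  tagged_partition K t C ->
  operator_sum (fun s => f s * g s) (existT _ m (t, C)) x =
  operator_sum f (existT _ m (t, C)) (operator_sum g (existT _ m (t, C)) x).
Proof.
move=> PC; apply: eq_bigr => j _ /=; rewrite -scalerA; congr (_ *: _).
have bC := tagged_partition_borel PC.
have lin := pvm_linear pvmE (bC j).
have E0 : E (C j) 0 = 0 by have := linear_scaler 0 0 lin; rewrite !scale0r.
have ED u v : E (C j) (u + v) = E (C j) u + E (C j) v.
  by rewrite -[u]scale1r lin !scale1r.
rewrite /operator_sum (big_morph _ ED E0) (bigD1 j)//= big1 ?addr0.
  by rewrite (linear_scaler _ _ lin) (pvm_idem pvmE).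
move=> i ij; rewrite (linear_scaler _ _ lin) -(pvmI pvmE)//.
by rewrite setIC (tagged_partition_disjoint PC ij) (pvm0 pvmE) scaler0.
Qed.

Lemma operator_sum1 m (t : 'I_m -> R) (C : 'I_m -> set R) x :
  tagged_partition K t C -> operator_sum (fun=> 1) (existT _ m (t, C)) x = x.
Proof.
move=> PC; rewrite /operator_sum; under eq_bigr do rewrite scale1r.
rewrite /= -(pvm_additive pvmE).
- by have [_ -> _ _] := PC; rewrite (pvmK pvmE).
- exact: tagged_partition_borel PC.
- exact: tagged_partition_disjoint PC.
Qed.

Lemma dot_operator_sum f P x y : dot (operator_sum f P x) y =
  HK_sum f (spectral_mu dot E x y) (projT2 P).1 (projT2 P).2.
Proof.
by rewrite linear_sumlz; apply: eq_bigr => j _; rewrite /= dotZl.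
Qed.

Lemma dot_operator_sum_conj f m (t : 'I_m -> R) (C : 'I_m -> set R) x y :
  tagged_partition K t C ->
  dot (operator_sum f (existT _ m (t, C)) x) y =
  dot x (operator_sum (fun s => scalar_conj (f s)) (existT _ m (t, C)) y).
Proof.
move=> PC; rewrite linear_sumlz linear_sumr; apply: eq_bigr => j _ /=.
rewrite dotZl dotZr scalar_conjK (pvm_self_adjoint pvmE)//.
exact: tagged_partition_borel PC j.
Qed.

(* Both sums are written over the common refinement; off N its nonempty
   cells carry coefficients at most e, so the operator bound applies to the
   components of x in the ranges of E (K `\` N) and E N separately. *)
Lemma operator_sum_dist f M e N m (t : 'I_m -> R) (C : 'I_m -> set R)
    m' (t' : 'I_m' -> R) (C' : 'I_m' -> set R) x :
  0 <= M -> 0 <= e -> (forall s, K s -> `|f s| <= M) -> borel_in K N ->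
  tagged_partition K t C -> tagged_partition K t' C' ->
  (forall i j s, C i s -> C' j s -> ~ N s -> `|f (t i) - f (t' j)| <= e) ->
  `|operator_sum f (existT _ m (t, C)) x -
    operator_sum f (existT _ m' (t', C')) x| <=
  e * `|x| + (M + M) * `|E N x|.
Proof.
move=> M0 e0 fM bN PC PC' fe.
have bC := tagged_partition_borel PC; have bC' := tagged_partition_borel PC'.
have dC := tagged_partition_disjoint PC.
have dC' := tagged_partition_disjoint PC'.
have KC := tagged_partition_tag PC; have KC' := tagged_partition_tag PC'.
pose D (p : 'I_m * 'I_m') := C p.1 `&` C' p.2.
have bD p : borel_in K (D p) by exact: borel_inI.
have dD p q : p != q -> D p `&` D q = set0.
  case: p q => [i j] [i' j']; rewrite xpair_eqE negb_and => /orP[/dC|/dC'] d0;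
  by apply/seteqP; split=> // s [[/= s1 s2] [s3 s4]];
    have : (set0 : set R) s by rewrite -d0.
have CE i : E (C i) x = \sum_j E (D (i, j)) x.
  rewrite -(pvm_additive pvmE).
  - congr (E _ x); rewrite /D/= -setI_bigcupr.
    have [_ -> _ _] := PC'; apply/esym/setIidPl; exact: (bC i).2.
  - by move=> j; exact: bD.
  - by move=> j j' jj'; apply: dD; rewrite xpair_eqE negb_and jj' orbT.
have CE' j : E (C' j) x = \sum_i E (D (i, j)) x.
  rewrite -(pvm_additive pvmE).
  - congr (E _ x); rewrite /D/= -setI_bigcupl.
    have [_ -> _ _] := PC; apply/esym/setIidPr; exact: (bC' j).2.
  - by move=> i; exact: bD.
  - by move=> i i' ii'; apply: dD; rewrite xpair_eqE negb_and ii'.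
pose a (p : 'I_m * 'I_m') := f (t p.1) - f (t' p.2).
have bKN : borel_in K (K `\` N) by apply: borel_inD => //; exact: borel_in_self.
(* Each [E (D p) x] is split into its parts outside and inside N; the inside part is written
   [E (D p) (E N x)], which makes [E N x] the vector to be bounded. *)
have -> : operator_sum f (existT _ m (t, C)) x -
    operator_sum f (existT _ m' (t', C')) x =
    \sum_p a p *: E (D p `&` (K `\` N)) x + \sum_p a p *: E (D p) (E N x).
  rewrite /operator_sum/=.
  under eq_bigr do rewrite CE scaler_sumr.
  under [X in _ - X]eq_bigr do rewrite CE' scaler_sumr.
  rewrite [X in _ - X]exchange_big/= !pair_bigA -sumrB -big_split/=.
  apply: eq_bigr => -[i j] _; rewrite /= -scalerBl -scalerDr; congr (_ *: _).
  rewrite -(pvmI pvmE)// -(pvmU pvmE) -?setIUr.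
  - congr (E _ x); apply/esym/setIidPl => s Ds.
    have Ks := (bD (i, j)).2 s Ds.
    by have [Ns|Ns] := pselect (N s); [right|left].
  - exact: borel_inI.
  - exact: borel_inI.
  - by apply/seteqP; split=> s // [[_ [_ nN]] [_ /nN]].
rewrite (le_trans (ler_normD _ _))// lerD//.
  apply: (norm_pvm_sum norm_dot pvmE) => //.
  - by move=> p; exact: borel_inI.
  - move=> p q /dD pq; apply/seteqP; split=> // s [[Dp _] [Dq _]].
    by have : (set0 : set R) s by rewrite -pq.
  - by case=> i j [s [[Ci Cj] [_ Ns]]]; exact: fe Ci Cj Ns.
apply: (norm_pvm_sum norm_dot pvmE) => //; first exact: addr_ge0.
by move=> p _; rewrite (le_trans (ler_normB _ _))// lerD// fM.
Qed.

End operator_sums.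

(** * The calculus as a strong limit of operator sums *)

Section calculus.
Context (R : realType) (k : scalar_kind).
Local Notation F := (scalars R k).
Context (H : completeNormedModType F) (dot : {dot H for @scalar_conj R k}).
Hypothesis norm_dot : forall x : H, `|x| ^+ 2 = dot x x.
Context (K : set R) (E : set R -> H -> H).
Hypotheses (closedK : closed K)
  (boundedK : exists M, forall r, K r -> `|r| <= M).
Hypothesis pvmE : projection_valued_measure dot K E.
Implicit Types (f g : R -> F) (x y : H).

Let properK : ProperFilter (HK_filter K) := HK_filter_proper closedK boundedK.
#[local] Existing Instance properK.

(* The gauge keeps the points of Q other than the tag out of each cell and
   makes the cells tagged in Q so small that, up to their tags, they lie in
   a punctured neighbourhood of Q of negligible spectral measure at x. *)
Lemma operator_sum_cvg f x : regulated K f ->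
  cvg (operator_sum E f P x @[P --> HK_filter K]).
Proof.
move=> rf; have [M M0 fM] := regulated_bounded closedK boundedK rf.
apply: cauchy_cvg; apply: cauchy_exP => e e0.
have e20 : 0 < e / 2 by rewrite divr_gt0.
have [d d0 dx] : exists2 d : F, 0 < d & d * `|x| < e / 2.
  exists (e / 2 / (`|x| + 1)); first by rewrite divr_gt0// ltr_pwDr.
  rewrite mulrAC ltr_pdivrMr ?ltr_pwDr// ltr_pM2l// ltrDl//.
have [Q fQ] := regulated_gaps closedK boundedK rf d0.
pose N n : set R := K `&` punctured Q n.+1%:R^-1.
have bN n : borel_in K (N n).
  split; last by move=> s [].
  by apply: measurableI; [exact: closed_measurable|exact: measurable_punctured].
have [n Nx] : exists n, (M + M) * `|E (N n) x| < e / 2.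
  have d1 : 0 < e / 2 / (M + M + 1) by rewrite divr_gt0// ltr_pwDr// addr_ge0.
  have cN : E (N n) x @[n --> \oo] --> (0 : H).
    apply: (pvm_decreasing pvmE) => // [n s [Ks Ps]|].
      split=> //; apply: punctured_le Ps.
      by rewrite lef_pV2 ?posrE// ler_nat.
    apply/seteqP; split=> // s sN.
    rewrite -(punctured_bigcap Q) => n _.
    by have [] := sN n I.
  have [n _ /(_ n (leqnn n))/=] := cvgr0_norm_lt _ cN _ d1.
  rewrite ltr_pdivlMr ?ltr_pwDr ?addr_ge0// => h; exists n.
  by rewrite (le_lt_trans _ h)// mulrC ler_wpM2l// lerDl.
have /choice[r rP] t : exists r : R, 0 < r /\
    forall q, q \in Q -> q != t -> r <= `|q - t|.
  by have [r r0 h] := seq_separated Q t; exists r.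
pose gamma t := Num.min (r t) n.+1%:R^-1.
have g0 t : K t -> 0 < gamma t by move=> _; rewrite lt_min (rP t).1/=.
have [m [t [C [PC fC]]]] := cousin closedK boundedK g0.
(* One fixed fine sum is the centre of a ball of radius e that contains all [gamma]-fine sums. *)
exists (operator_sum E f (existT _ m (t, C)) x), gamma => // m' t' C' PC' fC'.
rewrite -ball_normE/=.
apply: (le_lt_trans (operator_sum_dist norm_dot closedK pvmE x M0 (ltW d0) fM
  (bN n) PC PC' _)); last by rewrite (splitr e) ltrD.
move=> i j s Ci Cj Ns.
have [/andP[ts1 ts2] Ks] := (gauge_fineP _ _ _ _).1 fC i s Ci.
have [/andP[ts1' ts2'] _] := (gauge_fineP _ _ _ _).1 fC' j s Cj.
have Kt := tagged_partition_tag PC i; have Kt' := tagged_partition_tag PC' j.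
move: (t i) (t' j) Kt Kt' ts1 ts2 ts1' ts2' => u u' Ku Ku' ts1 ts2 ts1' ts2'.
have [->|uu'] := eqVneq u u'; first by rewrite subrr normr0 ltW.
have gr v : gamma v <= r v by rewrite ge_min lexx.
have gn v : gamma v <= n.+1%:R^-1 by rewrite ge_min lexx orbT.
(* Otherwise s would lie in the punctured neighbourhood around v, that is, in N. *)
have tagQ v : v - gamma v < s -> s < v + gamma v -> v \in Q -> s = v.
  move=> h1 h2 vQ; apply/eqP/negPn/negP => sv; apply: Ns; split=> //.
  apply: (puncturedP vQ sv); have := gn v.
  by move: (n.+1%:R^-1 : R) => c cv; lra.
(* A point of Q other than v is at least [r v] away from v, so it does not separate v from s. *)
have far v q : v - gamma v < s -> s < v + gamma v -> q \in Q -> q != v ->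
    (q < v) && (q < s) || (v < q) && (s < q).
  move=> h1 h2 qQ qv; have := (rP v).2 q qQ qv; have := gr v.
  move: qv; rewrite neq_lt => /orP[qv|qv].
    by rewrite ltr0_norm ?subr_lt0// => *; apply/orP; left; lra.
  by rewrite gtr0_norm ?subr_gt0// => *; apply/orP; right; lra.
apply: fQ => // q qQ.
(* If the tag u were q, then s would be q too, and the cell tagged at u' would contain a point of Q
   other than its tag. *)
have qu : q != u.
  apply/eqP => qu; have su : s = u by apply: tagQ; rewrite // -qu.
  have := far u' q ts1' ts2' qQ; rewrite qu su => /(_ uu').
  by rewrite !ltxx !andbF.
have qu' : q != u'.
  apply/eqP => qu'; have su : s = u' by apply: tagQ; rewrite // -qu'.
  have := far u q ts1 ts2 qQ qu; rewrite qu' su.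
  by rewrite !ltxx !andbF.
(* Both tags lie on the same side of q as the common point s of their cells. *)
move: (far u q ts1 ts2 qQ qu) (far u' q ts1' ts2' qQ qu').
case/orP=> /andP[h1 h2] /orP[]/andP[h3 h4]; first by rewrite h1 h3.
- by have := lt_trans h2 h4; rewrite ltxx.
- by have := lt_trans h4 h2; rewrite ltxx.
- by rewrite h1 h3 orbT.
Qed.

(** Strong convergence is asked for because weak limits, which the integrals against [spectral_mu]
    express, do not pass to products. *)
Definition strong_HK f (T : H -> H) :=
  forall x, operator_sum E f P x @[P --> HK_filter K] --> T x.

(** The filter sees only tagged partitions, so identities valid for these can be used under the
    limit. *)
Lemma cvg_near_partition (V : topologicalType) (u v : tagged_family R -> V)
    (l : V) :
  (forall m (t : 'I_m -> R) (C : 'I_m -> set R), tagged_partition K t C ->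
    u (existT _ m (t, C)) = v (existT _ m (t, C))) ->
  u P @[P --> HK_filter K] --> l -> v P @[P --> HK_filter K] --> l.
Proof.
move=> uv; apply: cvg_trans; apply: near_eq_cvg.
by exists (fun=> 1) => // m t C PC _ /=; rewrite uv.
Qed.

(** Linearity and the bound M of f pass to the limit, since each sum is linear and bounded by M
    whatever the partition. *)
Lemma strong_HK_exists f : regulated K f ->
  exists2 T, bounded_operator T & strong_HK f T.
Proof.
move=> rf; have [M M0 fM] := regulated_bounded closedK boundedK rf.
have /choice[T TP] x :
    exists y, operator_sum E f P x @[P --> HK_filter K] --> y.
  by have /cvg_ex := operator_sum_cvg (x := x) rf.
exists T => //; split.
  move=> a x y; apply: norm_cvg_unique (TP _) _.
  apply: cvg_near_partition (cvgD (cvgZ (cvg_cst a) (TP x)) (TP y)) => m t C PC.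
  by rewrite (operator_sum_linear closedK pvmE f PC).
exists M => x; apply/ler_addgt0Pr => e e0.
move/cvgrPdist_lt : (TP x) => /(_ _ e0) h.
have hK := HK_filter_partition (fun t (_ : K t) => ltr01).
have [[m [t C]] [[/= PC _] hP]] := filter_ex (filterI hK h).
rewrite -(subrK (operator_sum E f (existT _ m (t, C)) x) (T x)).
rewrite (le_trans (ler_normD _ _))// addrC lerD ?(ltW hP)//.
exact: (norm_operator_sum norm_dot closedK pvmE).
Qed.

Lemma strong_HK_unique f S T : strong_HK f S -> strong_HK f T -> S = T.
Proof.
by move=> fS fT; apply/funext => x; exact: norm_cvg_unique (fS x) (fT x).
Qed.

Lemma strong_HK_integral f T x y : strong_HK f T ->
  HK_integral K (spectral_mu dot E x y) f (dot (T x) y).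
Proof.
move=> fT; apply/HK_integralP.
apply: cvg_trans (cvg_dotl norm_dot (y := y) (fT x)).
apply: near_eq_cvg; apply: nearW => P.
by rewrite /= dot_operator_sum.
Qed.

Lemma HK_integral_unique (mu : set R -> F) f (a b : F) :
  HK_integral K mu f a -> HK_integral K mu f b -> a = b.
Proof. by move=> /HK_integralP fa /HK_integralP; exact: norm_cvg_unique. Qed.

Lemma strong_HKD (a b : F) f g S T : strong_HK f S -> strong_HK g T ->
  strong_HK (fun t => a * f t + b * g t) (fun x => a *: S x + b *: T x).
Proof.
move=> fS gT x.
apply: cvg_trans (cvgD (cvgZ (cvg_cst a) (fS x)) (cvgZ (cvg_cst b) (gT x))).
apply: near_eq_cvg; apply: nearW => P /=.
rewrite fctE /operator_sum !scaler_sumr -big_split/=; apply: eq_bigr => j _.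
by rewrite !scalerA -scalerDl.
Qed.

(** [S (T x)] is compared with [fP (T x)], and this with [fP (gP x)]; the second difference is small
    because the sums [fP] are bounded by M uniformly in the partition. *)
Lemma strong_HKM f g S T : regulated K f -> strong_HK f S -> strong_HK g T ->
  strong_HK (fun t => f t * g t) (S \o T).
Proof.
move=> rf fS gT x; have [M M0 fM] := regulated_bounded closedK boundedK rf.
apply/cvgrPdist_lt => e e0; have e20 : 0 < e / 2 by rewrite divr_gt0.
have d0 : 0 < e / 2 / (M + 1) by rewrite divr_gt0// ltr_pwDr.
move/cvgrPdist_lt : (fS (T x)) => /(_ _ e20) hS.
move/cvgrPdist_lt : (gT x) => /(_ _ d0) hT.
have hP := HK_filter_partition (fun t (_ : K t) => ltr01).
apply: filterS (filterI hP (filterI hS hT)) => -[m [t C]].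
move=> [[/= PC _] [{}hS {}hT]].
rewrite (operator_sumM closedK pvmE f g x PC).
set fP := operator_sum E f _ in hS *; set gP := operator_sum E g _ in hT *.
rewrite (le_lt_trans (ler_distD (fP (T x)) _ _))// (splitr e) ltrD//.
rewrite -(linear_subr _ _ (operator_sum_linear closedK pvmE f PC)).
rewrite (le_lt_trans (norm_operator_sum norm_dot closedK pvmE _ M0 fM PC))//.
move: hT; rewrite ltr_pdivlMr ?ltr_pwDr// => hT.
by rewrite (le_lt_trans _ hT)// mulrC ler_wpM2l// lerDl.
Qed.

Lemma strong_HK1 : strong_HK (fun=> 1) idfun.
Proof.
move=> x; apply: cvg_near_partition (cvg_cst x) => m t C PC.
by rewrite (operator_sum1 closedK pvmE).
Qed.

(** The adjoint relation holds for each pair of sums, and the inner product is continuous in either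
    argument. *)
Lemma strong_HK_adjoint f S T : strong_HK f S ->
  strong_HK (fun t => scalar_conj (f t)) T -> adjoint_of dot S T.
Proof.
move=> fS fT x y; apply: norm_cvg_unique (cvg_dotl norm_dot (y := y) (fS x)) _.
apply: cvg_near_partition (cvg_dotr norm_dot (x := x) (fT y)) => m t C PC.
by rewrite (dot_operator_sum_conj closedK pvmE _ _ _ PC).
Qed.

(** The inner product separates vectors, so [xget] chooses from a singleton. *)
Lemma adjoint_of_adjoint T S : bounded_operator S -> adjoint_of dot T S ->
  adjoint dot T = S.
Proof.
move=> bS TS; apply: xget_unique => // S' [_ TS'].
apply/funext => y; apply: (dot_inj norm_dot) => z.
by rewrite dot_conj [RHS]dot_conj -TS -TS'.
Qed.

End calculus.

(** Links the weak definition of f(A) to strong limits: a strong limit T satisfies it and, integrals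
    being unique, any operator satisfying it has the same inner products as T. *)
Lemma HK_calculusE (R : realType) (k : scalar_kind)
    (H : completeNormedModType (scalars R k))
    (dot : {dot H for @scalar_conj R k})
    (norm_dot : forall x : H, `|x| ^+ 2 = dot x x)
    (A : H -> H) (bounded_A : bounded_operator A)
    (E : set R -> H -> H)
    (pvmE : projection_valued_measure dot (real_spectrum A) E)
    (f : R -> scalars R k) (T : H -> H) :
  bounded_operator T -> strong_HK (real_spectrum A) E f T ->
  HK_calculus dot A E f = T.
Proof.
move=> bT fT; apply: xget_unique => [|S [_ fS]].
  by split=> // x y; exact: strong_HK_integral.
apply/funext => x; apply: (dot_inj norm_dot) => y.
apply: HK_integral_unique (fS x y) _; last exact: strong_HK_integral.
- exact: closed_real_spectrum.
- exact: real_spectrum_bounded.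
Qed.

Theorem theorem4p1 (R : realType) (k : scalar_kind)
    (H : completeNormedModType (scalars R k))
    (dot : {dot H for @scalar_conj R k})
    (norm_dot : forall x : H, `|x| ^+ 2 = dot x x)
    (A : H -> H) (bounded_A : bounded_operator A)
    (self_adjoint_A : self_adjoint dot A)
    (E : set R -> H -> H) (spectral_E : spectral_measure dot A E) :
  let K := real_spectrum A in
  let Phi := HK_calculus dot A E in
  [/\ forall (a1 a2 : scalars R k) (f1 f2 : R -> scalars R k),
        regulated K f1 -> regulated K f2 ->
        Phi (fun t => a1 * f1 t + a2 * f2 t) =
          (fun x => a1 *: Phi f1 x + a2 *: Phi f2 x),
      forall f1 f2 : R -> scalars R k, regulated K f1 -> regulated K f2 ->
        Phi (fun t => f1 t * f2 t) = Phi f1 \o Phi f2,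
      forall f3 : R -> scalars R k, regulated K f3 ->
        Phi (fun t => scalar_conj (f3 t)) = adjoint dot (Phi f3)
    & Phi (fun=> 1) = idfun].
Proof.
move=> K Phi; have [pvmE _] := spectral_E.
have clK : closed K := closed_real_spectrum bounded_A.
have bK := real_spectrum_bounded bounded_A.
have PhiE := HK_calculusE norm_dot bounded_A pvmE.
(* For regulated f the value [Phi f] is thus a genuine strong limit and not the default of
   [xget]. *)
have ex f (rf : regulated K f) :
    bounded_operator (Phi f) /\ strong_HK K E f (Phi f).
  have [T bT fT] := strong_HK_exists norm_dot clK bK pvmE rf.
  by rewrite /Phi (PhiE _ _ bT fT).
split.
- move=> a1 a2 f1 f2 rf1 rf2; have [_ h1] := ex _ rf1; have [_ h2] := ex _ rf2.
  (* The combination is itself regulated, so both sides are strong limits of the same sums. *)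
  have [bT fT] := ex _ (regulatedD (regulatedM (regulated_cst (K := K) a1) rf1)
    (regulatedM (regulated_cst (K := K) a2) rf2)).
  exact: (strong_HK_unique clK bK fT (strong_HKD (a := a1) (b := a2) h1 h2)).
- move=> f1 f2 rf1 rf2; have [b1 h1] := ex _ rf1; have [b2 h2] := ex _ rf2.
  apply: PhiE; first exact: bounded_operator_comp.
  exact: (strong_HKM norm_dot clK bK pvmE rf1 h1 h2).
- move=> f3 rf3; have [_ h3] := ex _ rf3.
  have [b3 h3'] := ex _ (regulated_conj rf3).
  apply/esym/(adjoint_of_adjoint norm_dot) => //.
  exact: (strong_HK_adjoint norm_dot clK bK pvmE h3 h3').
- apply: PhiE; last exact: (strong_HK1 clK pvmE).
  by split=> //; exists 1 => x; rewrite mul1r.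
Qed.
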